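(* Let $\{L_t\}_{t\ge0},\{U_t\}_{t\ge1}$ satisfy the Simplified Recursion with constants $C_1,C_2,C_3>0$, where the step sizes are $\eta_t=\frac{2}{C_1(t+L)}$ for all $t\ge1$, for some integer $L\ge3$. Let $a>0$ and $\delta\in(0,1)$, and assume $\mathbb P(L_0\le a)\ge1-\delta$. Define $$K:=\max\{L-2;32\}\cdot\big(\mathbf 1_{\{L\ge32\}}+32\cdot\mathbf 1_{\{L\le31\}}\big).$$ Then $$\mathbb P\Big(\forall t\ge0:\ L_t\le 31.5\,K\max\Big\{\frac{aL}{\log(\delta^{-1})};\frac{C_2}{C_1^2};\frac{C_3^2}{C_1^2}\Big\}\frac{\log(\delta^{-1})+2\log\log(t+9)}{t+L}\Big)\ge1-2\delta.$$
   Context: Simplified Recursion: on a probability space with filtration $\{\mathcal F_t\}_{t\ge0}$, $\{L_t\}_{t\ge0}$ is a non-negative adapted process, $\{U_t\}_{t\ge1}$ is a real adapted process, $\{\eta_t\}_{t\ge1}$ is a deterministic positive sequence of step sizes, and almost surely for all $t\ge1$: $L_t\le(1-C_1\eta_t)L_{t-1}+U_t$, $\ \big|\mathbb E(U_t\mid\mathcal F_{t-1})\big|\le C_2\eta_t^2$, $\ |U_t|\le C_3\eta_t\sqrt{L_{t-1}}+C_2\eta_t^2$. *)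

(* Defs.v *)
From HB Require Import structures.
From mathcomp Require Import all_boot all_order all_algebra.
From mathcomp Require Import all_classical all_reals all_analysis.
Set Implicit Arguments. Unset Strict Implicit. Unset Printing Implicit Defensive.
Import Order.TTheory GRing.Theory Num.Theory.
Local Open Scope classical_set_scope.
Local Open Scope ring_scope.

Definition filtration d (T : measurableType d) (F : nat -> set (set T)) : Prop :=
  (forall t, sigma_algebra setT (F t)) /\
  (forall t, F t `<=` measurable) /\
  (forall s t, (s <= t)%N -> F s `<=` F t).

Definition adapted d (T : measurableType d) (R : realType)
    (F : nat -> set (set T)) (X : nat -> T -> R) : Prop :=
  forall t (B : set R), measurable B -> F t (X t @^-1` B).

Definition is_cond_exp d (T : measurableType d) (R : realType)
    (P : probability T R) (G : set (set T)) (U Y : T -> R) : Prop :=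
  (forall B : set R, measurable B -> G (Y @^-1` B)) /\
  (forall A, G A -> P.-integrable A (EFin \o U) ->
     P.-integrable A (EFin \o Y) /\
     (\int[P]_(x in A) (U x)%:E = \int[P]_(x in A) (Y x)%:E)%E).

(* Main.v *)
Require Import Defs.
From HB Require Import structures.
From mathcomp Require Import all_boot all_order all_algebra.
From mathcomp Require Import all_classical all_reals all_analysis.
From mathcomp Require Import measurable_realfun ring lra zify.
Set Implicit Arguments.
Unset Strict Implicit.
Unset Printing Implicit Defensive.
Import Order.TTheory GRing.Theory Num.Theory.
Import HBNNSimple.
Local Open Scope classical_set_scope.
Local Open Scope ring_scope.

(** Write A for the maximum in the bound, b_t = log(1/delta) + 2 log log(t+9),
    N_t = t + L and w_t = N_t (N_t - 1).  Since 1 - C1 eta_t = (N_t - 2) / N_t,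
    multiplying the recursion by w_t telescopes it into
      w_t L_t <= L (L - 1) L_0 + sum_(s <= t) w_s U_s.
    As long as L_s <= 1008 A b_s / N_s (and 1008 <= 31.5 K), the centered
    increments w_s (U_s - E(U_s | F_(s-1))) have squares at most
    v_s = 9072 A^2 N_(s-1) b_(s-1), while the conditional means add up to at
    most 4 A t.  A first violation at time t therefore forces the stopped sum of
    centered increments above 1003 A b_t (N_t - 1).  For the dyadic epoch
    2^k L <= N_t < 2^(k+1) L take the rate lambda = 1 / (120 A 2^k L): the
    exponential supermartingale with compensator 2 lambda^2 v_s then exceeds
    exp(2 b_t) >= (k+1) (k+2) / delta at the violation and stays constant
    afterwards.  Markov's inequality at the end of each epoch bounds the
    probability of a violation by sum_k delta / ((k+1) (k+2)) = delta, to which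
    the probability delta of L_0 > a is added. *)

(** * Nonnegative supermartingales through integrals over events of a sub-sigma-algebra *)

(** Plays the role of E(W E(f | G)) <= E(W) when E(f | G) <= 1, with the conditional bound phrased
    through events of [G] only. The hypothesis is the case of indicators; linearity gives simple
    [W], monotone convergence the rest. *)
Lemma ge0_le_integral_mul_sub_sigma_algebra (d : measure_display)
    (T : measurableType d) (R : realType) (mu : {measure set T -> \bar R})
    (G : set (set T)) (f W : T -> R) :
  sigma_algebra setT G -> G `<=` measurable ->
  measurable_fun setT f -> (forall x, 0 <= f x) -> (forall x, 0 <= W x) ->
  measurable_fun [set: g_sigma_algebraType G] (W : g_sigma_algebraType G -> R) ->
  (forall A, G A -> (\int[mu]_(x in A) (f x)%:E <= mu A)%E) ->
  (\int[mu]_x (W x * f x)%:E <= \int[mu]_x (W x)%:E)%E.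
Proof.
move=> sG Gm mf f0 W0 mW intf.
have GE : @measurable _ (g_sigma_algebraType G) = G.
  exact: measurable_g_measurableTypeE.
have GP A : @measurable _ (g_sigma_algebraType G) A -> G A by rewrite GE.
have Gmf (g : T -> R) :
    measurable_fun [set: g_sigma_algebraType G] (g : g_sigma_algebraType G -> R) ->
    measurable_fun [set: T] g.
  by move=> mg _ B mB; apply/Gm/GP; exact: mg.
(* The approximation is taken over [G] rather than the ambient sigma-algebra, so that the level sets
   of [h n] lie in [G] and [intf] applies to them. *)
pose h := nnsfun_approx (@measurableT _ (g_sigma_algebraType G))
  (proj2 (measurable_EFinP _ _) mW).
have W0E x : [set: g_sigma_algebraType G] x -> (0 <= (EFin \o W) x)%E.
  by move=> _; rewrite lee_fin.
have hW x : (EFin \o h n) x @[n --> \oo] --> (W x)%:E.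
  exact: (cvg_nnsfun_approx measurableT (proj2 (measurable_EFinP _ _) mW) W0E).
have ndh x : nondecreasing_seq (fun n => h n x).
  by move=> m n mn; exact/lefP/nd_nnsfun_approx.
have mh n : measurable_fun [set: T] (h n : T -> R).
  by apply: Gmf; exact: measurable_funP.
have mhi n (r : R) : G (h n @^-1` [set r]) by apply: GP; exact: measurable_funPTI.
have -> : (\int[mu]_x (W x * f x)%:E =
    lim (\int[mu]_x (h n x * f x)%:E @[n --> \oo]))%E.
  have Wf x : (W x * f x)%:E = lim ((h n x * f x)%:E @[n --> \oo]).
    apply/esym/cvg_lim => //; under eq_fun do rewrite EFinM.
    by rewrite EFinM; apply: cvgeZr => //; exact: hW.
  under eq_integral do rewrite Wf.
  apply: monotone_convergence => //.
  - by move=> n; apply/measurable_EFinP; exact: measurable_funM.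
  - by move=> n x _; rewrite lee_fin mulr_ge0.
  - by move=> x _ m n mn; rewrite lee_fin ler_wpM2r//; exact: ndh.
have leh n : (\int[mu]_x (h n x)%:E <= \int[mu]_x (W x)%:E)%E.
  apply: ge0_le_integral => //; try by move=> x _; rewrite lee_fin.
  - exact/measurable_EFinP.
  - by apply/measurable_EFinP; exact: Gmf.
  - move=> x _.
    rewrite -(cvg_lim _ (hW x))//; apply: lime_ge; first exact: cvgP (hW x).
    by exists n => // m /= nm; rewrite lee_fin; exact: ndh.
apply: lime_le.
  apply: ereal_nondecreasing_is_cvgn => m n mn.
  apply: ge0_le_integral => //; try by move=> x _; rewrite lee_fin mulr_ge0.
  - by apply/measurable_EFinP; exact: measurable_funM.
  - by apply/measurable_EFinP; exact: measurable_funM.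
  - by move=> x _; rewrite lee_fin ler_wpM2r//; exact: ndh.
apply: nearW => n; apply: le_trans (leh n).
have hE x : h n x = \sum_(y \in range (h n)) (y * \1_(h n @^-1` [set y]) x).
  exact: fimfunE.
have fr : finite_set (range (h n)) by exact: fimfunP.
have r0 y : y \in range (h n) -> 0 <= y by rewrite inE => -[x _ <-].
have mind y : measurable_fun [set: T] (\1_(h n @^-1` [set y]) : T -> R).
  by apply: measurable_indic; exact/Gm/mhi.
have -> : (\int[mu]_x (h n x * f x)%:E = \sum_(y \in range (h n))
    y%:E * \int[mu]_(x in h n @^-1` [set y]) (f x)%:E)%E.
  transitivity (\int[mu]_x (\sum_(y \in range (h n))
      (y * \1_(h n @^-1` [set y]) x * f x)%:E))%E.
    by apply: eq_integral => x _; rewrite hE mulr_fsuml// -fsumEFin.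
  rewrite ge0_integral_fsum//; last 2 first.
  - by move=> y; apply/measurable_EFinP; do 2!apply: measurable_funM => //.
  - move=> y x _; rewrite lee_fin mulr_ge0//; exact: nnfun_muleindic_ge0.
  apply: eq_fsbigr => y yh.
  under eq_integral do rewrite -mulrA EFinM.
  rewrite ge0_integralZl//; last 3 first.
  - by apply/measurable_EFinP; exact: measurable_funM.
  - by move=> x _; rewrite lee_fin mulr_ge0.
  - by rewrite lee_fin r0.
  rewrite [in RHS]integral_mkcond; congr (_ * _)%E; apply: eq_integral => x _.
  by rewrite epatch_indic EFinM muleC.
have -> : (\int[mu]_x (h n x)%:E = \sum_(y \in range (h n))
    y%:E * mu (h n @^-1` [set y]))%E.
  transitivity (\int[mu]_x (\sum_(y \in range (h n))
      (y * \1_(h n @^-1` [set y]) x)%:E))%E.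
    by apply: eq_integral => x _; rewrite hE -fsumEFin.
  rewrite ge0_integral_fsum//; last 2 first.
  - by move=> y; apply/measurable_EFinP; apply: measurable_funM => //.
  - move=> y x _; rewrite lee_fin; exact: nnfun_muleindic_ge0.
  apply: eq_fsbigr => y yh.
  under eq_integral do rewrite EFinM.
  rewrite ge0_integralZl//; last 2 first.
  - exact/measurable_EFinP.
  - by rewrite lee_fin r0.
  by rewrite integral_indic ?setIT//; exact/Gm/mhi.
apply: lee_fsum => // y yh.
apply: lee_wpmul2l; first by rewrite lee_fin r0// inE.
exact: intf.
Qed.

(** This is exp y <= 1 / (1 - y) for y < 1, the source of the numerical upper bounds on exp
    below. *)
Lemma expR_mul1B_le1 (R : realType) (y : R) : expR y * (1 - y) <= 1.
Proof.
by rewrite -[leRHS](expRxMexpNx_1 y) ler_wpM2l ?expR_ge0//; exact: expR_ge1Dx.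
Qed.

(** Taking expectations kills the linear term of a centered variable, which leaves a sub-Gaussian
    bound with no size restriction on [y]. If y >= 1/2 then y <= 2 y^2; otherwise exp y <= 1 / (1 -
    y) <= 1 + y + 2 y^2. *)
Lemma expR_le_add_expR_sqr (R : realType) (y : R) :
  expR y <= y + expR (2 * y ^+ 2).
Proof.
have e2 := expR_ge1Dx (2 * y ^+ 2).
have [y2|y2] := lerP (2^-1) y.
  apply: (@le_trans _ _ (expR (2 * y ^+ 2))); last by rewrite lerDr; lra.
  by rewrite ler_expR; nra.
rewrite -(@ler_pM2r _ (1 - y)); last by lra.
apply: le_trans (expR_mul1B_le1 y) _.
apply: (@le_trans _ _ ((1 + y + 2 * y ^+ 2) * (1 - y))).
  by have := sqr_ge0 y; nra.
by rewrite ler_wpM2r//; lra.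
Qed.

(** One step of the supermartingale: off [A0] the integrand is 1, and on [A0] it lies below an
    affine function of U - Y whose linear part integrates to 0 over events of [G]. The bound [c]
    makes [U] integrable on the part inside [A0], as [is_cond_exp] requires. *)
Lemma le_integral_expR_cond_exp (d : measure_display) (T : measurableType d)
    (R : realType) (P : probability T R) (G : set (set T)) (U Y : T -> R)
    (A0 A : set T) (s v c : R) :
  sigma_algebra setT G -> G `<=` measurable -> measurable_fun setT U ->
  is_cond_exp P G U Y -> G A0 ->
  {ae P, forall x, A0 x -> `|U x| <= c} ->
  {ae P, forall x, A0 x -> 2 * (s * (U x - Y x)) ^+ 2 <= v} ->
  G A ->
  (\int[P]_(x in A) (if x \in A0 then expR (s * (U x - Y x) - v) else 1)%:E
    <= P A)%E.
Proof.
move=> sG Gm mU [GY UY] GA0 Uc Dv GA.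
have GE : @measurable _ (g_sigma_algebraType G) = G.
  exact: measurable_g_measurableTypeE.
have GI B C : G B -> G C -> G (B `&` C).
  by rewrite -GE; exact: measurableI.
have mY : measurable_fun setT Y.
  by move=> _ B mB; rewrite setTI; exact/Gm/GY.
set B := A `&` A0.
have GB : G B by exact: GI.
have mB := Gm _ GB; have mA := Gm _ GA; have mA0 := Gm _ GA0.
have iU : P.-integrable B (EFin \o U).
  apply/integrableP; split; first by apply/measurable_EFinP/measurable_funTS.
  apply: (@le_lt_trans _ _ (`|c|%:E * P B)%E).
    apply: integral_le_bound => //.
    - by apply/measurable_EFinP/measurable_funTS.
    - move: Uc; apply: filterS => x /= h [_ /h Ux].
      by rewrite lee_fin (le_trans Ux)// ler_norm.
  by rewrite ltey_eq fin_numM// fin_num_measure.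
have [iY UYE] := UY _ GB iU.
pose f x := (if x \in A0 then expR (s * (U x - Y x) - v) else 1)%:E.
change (\int[P]_(x in A) f x <= P A)%E.
have mD : measurable_fun setT (fun x => s * (U x - Y x)).
  by apply: measurable_funM => //; exact: measurable_funB.
have mf : measurable_fun setT f.
  apply/measurable_EFinP; apply: measurable_fun_ifT => //.
  - by apply: (measurable_fun_bool true); rewrite setTI preimage_mem_true.
  - by apply: measurableT_comp => //; exact: measurable_funB.
have f0 x : (0 <= f x)%E by rewrite lee_fin; case: ifP => // _; exact: expR_ge0.
have AE : A = B `|` (A `\` A0) by rewrite /B setUIDK.
have disj : [disjoint B & A `\` A0].
  by apply/disj_setPS => x [[_ +] [_]].
have mAD : measurable (A `\` A0) by exact: measurableD.
rewrite [in leRHS]AE measureU//; last exact/disj_set2P.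
rewrite [X in integral _ X]AE ge0_integral_setU//; last exact: measurable_funTS.
change (\int[P]_(x in B) f x + \int[P]_(x in A `\` A0) f x <=
  P B + P (A `\` A0))%E.
apply: leeD; last first.
  rewrite (eq_integral (cst 1%E)); last first.
    move=> x; rewrite inE => -[_ nx]; rewrite /f ifF//.
    by apply/negbTE; rewrite notin_setE.
  by rewrite integral_cst ?mul1e//.
(* This is exp y <= y + exp v, for y = s (U - Y) and 2 y^2 <= v, multiplied by exp (-v). *)
pose g x := ((expR (- v) * s) * (U x - Y x) + 1)%:E.
have iUY : P.-integrable B (EFin \o (fun x => U x - Y x)).
  have := integrableB mB iU iY; apply: eq_integrable => //.
have ig1 : P.-integrable B (fun x => ((expR (- v) * s) * (U x - Y x))%:E).
  have := integrableZl mB (expR (- v) * s) iUY.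
  by apply: eq_integrable => // x _; rewrite /= EFinM.
have ic : P.-integrable B (EFin \o cst 1) by exact: finite_measure_integrable_cst.
have ig : P.-integrable B g.
  by have := integrableD mB ig1 ic; apply: eq_integrable.
have gE : (\int[P]_(x in B) g x = P B)%E.
  have -> : (\int[P]_(x in B) g x = \int[P]_(x in B)
      (((expR (- v) * s) * (U x - Y x))%:E + (EFin \o cst 1%R) x))%E.
    by apply: eq_integral.
  rewrite integralD//.
  have -> : (\int[P]_(x in B) (EFin \o cst 1%R) x = P B)%E.
    by rewrite (integral_cst _ mB 1%:E) mul1e.
  have -> : (\int[P]_(x in B) ((expR (- v) * s) * (U x - Y x))%:E = 0)%E.
    under eq_integral do rewrite EFinM.
    rewrite (integralZl mB iUY).
    have -> : (\int[P]_(x in B) (U x - Y x)%:E = 0)%E.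
      rewrite (integralB_EFin mB iU iY) UYE subee//.
      exact: integrable_fin_num.
    by rewrite mule0.
  by rewrite add0e.
rewrite -[leRHS]gE.
(* Removing the null set where the variance bound fails makes the comparison of [f] and [g]
   pointwise. *)
have [N [mN PN0 subN]] := Dv.
rewrite (ge0_negligible_integral mN mB _ _ PN0)//; last exact: measurable_funTS.
rewrite [leRHS](negligible_integral mN mB ig PN0).
have fg x : (B `\` N) x -> (f x <= g x)%E.
  move=> [[_ A0x] Nx]; have Dx : 2 * (s * (U x - Y x)) ^+ 2 <= v.
    apply: contrapT => h; apply: Nx; apply: subN => /= /(_ A0x).
    exact: h.
  rewrite /f /g mem_set// lee_fin expRD mulrC -mulrA.
  rewrite -(@expRxMexpNx_1 R v) [expR v * _]mulrC -mulrDr.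
  rewrite ler_wpM2l ?expR_ge0//.
  apply: le_trans (expR_le_add_expR_sqr _) _.
  by rewrite lerD2l ler_expR.
have mBN : measurable (B `\` N) by exact: measurableD.
apply: ge0_le_integral => //.
- exact: measurable_funTS.
- apply: measurable_funS (measurable_int _ ig) => //.
Qed.

(** The last factor is peeled off: the product of the first n factors is measurable for [F n], where
    the next factor has conditional mean at most 1. *)
Lemma integral_prod_le1 (d : measure_display) (T : measurableType d)
    (R : realType) (P : probability T R) (F : nat -> set (set T))
    (f : nat -> T -> R) :
  filtration F ->
  (forall n x, 0 <= f n x) ->
  (forall n, measurable_fun [set: g_sigma_algebraType (F n.+1)]
     (f n : g_sigma_algebraType (F n.+1) -> R)) ->
  (forall n A, F n A -> (\int[P]_(x in A) (f n x)%:E <= P A)%E) ->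
  forall n, (\int[P]_x (\prod_(i < n) f i x)%:E <= 1)%E.
Proof.
move=> [sF [Fm Fle]] f0 mf intf n.
have FE m : @measurable _ (g_sigma_algebraType (F m)) = F m.
  exact: measurable_g_measurableTypeE.
have FP m A : @measurable _ (g_sigma_algebraType (F m)) A -> F m A by rewrite FE.
have PF m A : F m A -> @measurable _ (g_sigma_algebraType (F m)) A by rewrite FE.
have mZ m : measurable_fun [set: g_sigma_algebraType (F m)]
    ((fun x => \prod_(i < m) f i x) : g_sigma_algebraType (F m) -> R).
  elim: m => [|m IH].
    rewrite (_ : (fun _ => _) = cst 1); first exact: measurable_cst.
    by apply/funext => x; rewrite big_ord0.
  have IH' : measurable_fun [set: g_sigma_algebraType (F m.+1)]
    ((fun x => \prod_(i < m) f i x) : g_sigma_algebraType (F m.+1) -> R).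
    move=> _ B mB; apply: PF; apply: (Fle m m.+1 (leqnSn m)).
    by apply: FP; exact: IH.
  rewrite (_ : (fun _ => _) = (fun x => \prod_(i < m) f i x) \* f m).
    exact: measurable_funM.
  by apply/funext => x; rewrite big_ord_recr.
elim: n => [|n IH].
  under eq_integral do rewrite big_ord0.
  by rewrite (integral_cst _ measurableT 1%:E) mul1e probability_le1.
apply: le_trans IH.
under eq_integral do rewrite big_ord_recr.
apply: (@ge0_le_integral_mul_sub_sigma_algebra _ _ _ P (F n)) => //.
- by move=> _ B mB; apply/Fm/FP; exact: mf.
- by move=> x; exact: prodr_ge0.
- exact: intf.
Qed.

(** * Numerical bounds on exp and on the iterated logarithm *)

Lemma expR_half_le2 (R : realType) : expR (2^-1) <= 2 :> R.
Proof. by have := expR_mul1B_le1 (2^-1 : R); lra. Qed.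

Lemma expR1_le3 (R : realType) : expR 1 <= 3 :> R.
Proof.
(* Here exp(1/n) <= n / (n - 1), and n = 6 is the least n whose n-th power falls below 3. *)
have -> : expR 1 = expR 6^-1 ^+ 6 :> R by rewrite -expRM_natl divff.
have h : expR 6^-1 <= 6 / 5 :> R by have := expR_mul1B_le1 (6^-1 : R); lra.
apply: (@le_trans _ _ ((6 / 5) ^+ 6)); last by lra.
by apply: lerXn2r; rewrite ?nnegrE ?expR_ge0//; lra.
Qed.

Definition logterm (R : realType) (delta : R) (t : nat) : R :=
  ln delta^-1 + 2 * ln (ln (t%:R + 9)).

Section logterm.
Variables (R : realType) (delta : R).
Hypotheses (delta0 : 0 < delta) (delta1 : delta < 1).

(** The shift by 9 in [logterm] is explained here: exp 2 <= 3^2 = 9. *)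
Lemma ln_add9_ge2 (t : nat) : 2 <= ln (t%:R + 9) :> R.
Proof.
have t0 : 0 <= t%:R :> R by [].
rewrite -[leLHS]expRK ler_ln ?posrE ?expR_gt0//.
have -> : expR 2 = expR 1 ^+ 2 :> R by rewrite -expRM_natl mulr1.
have := expR1_le3 R; have := expR_ge0 (1 : R); nra.
Qed.

Lemma ln_deltaV_gt0 : 0 < ln delta^-1.
Proof. by rewrite ln_gt0// invf_gt1. Qed.

Lemma ln_deltaV_le_logterm t : ln delta^-1 + 1 <= logterm delta t.
Proof.
have h : 2^-1 <= ln (ln (t%:R + 9)) :> R.
  have l2 := ln_add9_ge2 t.
  rewrite -[leLHS]expRK ler_ln ?posrE ?expR_gt0//; last by lra.
  exact: le_trans (expR_half_le2 R) l2.
by rewrite /logterm; lra.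
Qed.

Lemma logterm_ge1 t : 1 <= logterm delta t.
Proof. by have := ln_deltaV_le_logterm t; have := ln_deltaV_gt0; lra. Qed.

Lemma le_logterm (s t : nat) : (s <= t)%N -> logterm delta s <= logterm delta t.
Proof.
move=> st; have st' : s%:R <= t%:R :> R by rewrite ler_nat.
have s0 : 0 <= s%:R :> R by [].
rewrite lerD2l ler_pM2l// ler_ln ?posrE.
- by rewrite ler_ln ?posrE; lra.
- by have := ln_add9_ge2 s; lra.
- by have := ln_add9_ge2 t; lra.
Qed.

(** The right side is l^4 / delta^2 with l = log(t+9). In epoch k, t + 9 >= 3 * 2^k >= exp(1 + k/2),
    so l >= (k+2)/2; together with l >= 2 this gives l^4 >= (k+2)^2. This is where the factor 2
    before the iterated logarithm pays for the union over epochs. *)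
Lemma epoch_le_expR_logterm (L k t : nat) : (3 <= L)%N -> (2 ^ k * L <= t + L)%N ->
  (k.+1 * k.+2)%:R / delta <= expR (2 * logterm delta t).
Proof.
move=> L3 kt.
set l := ln (t%:R + 9) : R.
have l2 : 2 <= l := ln_add9_ge2 t.
have t0 : 0 <= t%:R :> R by [].
have tk : (3 * 2 ^ k)%:R <= t%:R + 9 :> R.
  rewrite -natrD ler_nat.
  have h : ((2 ^ k - 1) * L <= t)%N by rewrite mulnBl mul1n; lia.
  have h2 : ((2 ^ k - 1) * 3 <= (2 ^ k - 1) * L)%N by rewrite leq_mul2l L3 orbT.
  lia.
have lk : k.+2%:R / 2 <= l.
  rewrite -[leLHS]expRK ler_ln ?posrE ?expR_gt0//.
  apply: le_trans tk.
  have -> : k.+2%:R / 2 = 1 + k%:R * 2^-1 :> R by rewrite -addn2 natrD; lra.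
  rewrite expRD expRM_natl natrM natrX.
  apply: ler_pM; rewrite ?expR_ge0 ?exprn_ge0 ?expR_ge0 ?expR1_le3//.
  by apply: lerXn2r; rewrite ?nnegrE ?expR_ge0// expR_half_le2.
have -> : expR (2 * logterm delta t) = delta^-1 ^+ 2 * l ^+ 4.
  rewrite /logterm -/l.
  have -> : 2 * (ln delta^-1 + 2 * ln l) = 2 * ln delta^-1 + 4 * ln l by lra.
  rewrite expRD !expRM_natl !lnK ?posrE ?invr_gt0//; lra.
have d1 : 1 <= delta^-1 by rewrite invf_ge1// ltW.
have k0 : 0 <= k%:R :> R by [].
rewrite natrM -[k.+2]addn2 -[k.+1]addn1 !natrD.
rewrite -[k.+2]addn2 natrD in lk.
apply: (@le_trans _ _ (l ^+ 4 / delta)).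
  rewrite ler_pM2r ?invr_gt0//.
  have l4 : (k%:R + 2) ^+ 2 / 4 <= l ^+ 2 by nra.
  have l4' : 4 <= l ^+ 2 by nra.
  by rewrite (_ : l ^+ 4 = l ^+ 2 * l ^+ 2); [nra|rewrite -exprD].
have l0 : 0 <= l ^+ 4 by apply: exprn_ge0; lra.
by nra.
Qed.

End logterm.

(** * Pathwise telescoping; [u s] and [y s] stand for the noise of step s+1 and its conditional
    mean *)

Section pathwise.
Variables (R : realType) (L : nat) (l u y : nat -> R) (A : R).
Hypothesis L3 : (3 <= L)%N.
Hypothesis A0 : 0 < A.

Let w (t : nat) : R := (t%:R + L%:R) * (t%:R + L%:R - 1).

Let L3R : 3 <= L%:R :> R. Proof. by rewrite (ler_nat _ 3). Qed.

Lemma weighted_recursion (t : nat) :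
  (forall s, (s < t)%N ->
    l s.+1 <= (1 - 2 / (s.+1%:R + L%:R)) * l s + u s) ->
  w t * l t <= w 0 * l 0 + \sum_(s < t) w s.+1 * u s.
Proof.
elim: t => [|t IH] h; first by rewrite big_ord0 addr0.
have t0 : 0 <= t%:R :> R by [].
have l3 := L3R.
rewrite big_ord_recr/= addrA.
apply: (@le_trans _ _ (w t * l t + w t.+1 * u t)); last first.
  by rewrite lerD2r; apply: IH => s st; apply: h; rewrite ltnW.
have wE : w t.+1 * (1 - 2 / (t.+1%:R + L%:R)) = w t.
  by rewrite /w -natr1; field; lra.
rewrite -wE -mulrA -mulrDr ler_wpM2l//; last exact: h.
by rewrite /w -natr1 mulr_ge0//; lra.
Qed.

(** In units of A b (N - 1), the weighted value at the violation exceeds 1008, the initial term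
    costs at most 1 and the drift at most 4, which leaves 1003. For [tau] = 0 the sum is empty and
    the conclusion rules out a violation. *)
Lemma violation_noise_ge (delta a : R) (tau : nat) :
  0 < delta -> delta < 1 -> a * L%:R <= A * ln delta^-1 -> l 0 <= a ->
  (forall s, (s < tau)%N ->
    l s.+1 <= (1 - 2 / (s.+1%:R + L%:R)) * l s + u s) ->
  (forall s, (s < tau)%N -> w s.+1 * `|y s| <= 4 * A) ->
  1008 * A * (logterm delta tau / (tau%:R + L%:R)) < l tau ->
  1003 * A * logterm delta tau * (tau%:R + L%:R - 1) <=
    \sum_(s < tau) w s.+1 * (u s - y s).
Proof.
move=> d0 d1 aA l0a hl hy ltau.
have rec := weighted_recursion hl.
set b := logterm delta tau in ltau *.
have b1 : 1 <= b by exact: logterm_ge1.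
have bl : ln delta^-1 + 1 <= b by exact: ln_deltaV_le_logterm.
have t0 : 0 <= tau%:R :> R by [].
have l3 := L3R.
set N := tau%:R + L%:R in ltau *.
have NL : L%:R <= N by rewrite /N; lra.
have -> : \sum_(s < tau) w s.+1 * (u s - y s) =
    \sum_(s < tau) w s.+1 * u s - \sum_(s < tau) w s.+1 * y s.
  by rewrite -sumrB; apply: eq_bigr => s _; rewrite mulrBr.
have ysum : \sum_(s < tau) w s.+1 * y s <= 4 * A * tau%:R.
  apply: (@le_trans _ _ (\sum_(s < tau) 4 * A)).
    apply: ler_sum => s _; apply: le_trans (hy s _) => //.
    rewrite ler_wpM2l ?ler_norm//.
    by have s0 : 0 <= s%:R :> R by []; rewrite /w -natr1 mulr_ge0//; lra.
  by rewrite sumr_const card_ord mulr_natr.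
have w0 : w 0 * l 0 <= A * b * (N - 1).
  apply: (@le_trans _ _ (a * L%:R * (L%:R - 1))).
    by rewrite /w add0r mulrC mulrA ler_wpM2r ?ler_wpM2r//; lra.
  apply: (@le_trans _ _ (A * ln delta^-1 * (L%:R - 1))).
    by rewrite ler_wpM2r//; lra.
  rewrite -!mulrA ler_wpM2l ?(ltW A0)//.
  have := ln_deltaV_gt0 d0 d1 => ?.
  by apply: ler_pM; lra.
have wt : 1008 * A * b * (N - 1) <= w tau * l tau.
  have -> : 1008 * A * b * (N - 1) = w tau * (1008 * A * (b / N)).
    by rewrite /w -/N; field; lra.
  by rewrite ler_wpM2l ?(ltW ltau)// /w -/N mulr_ge0//; lra.
have tb : 4 * A * tau%:R <= 4 * (A * b * (N - 1)).
  rewrite -!mulrA ler_wpM2l// ler_wpM2l ?(ltW A0)//.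
  apply: (@le_trans _ _ (1 * (N - 1))); first by rewrite /N; lra.
  by rewrite ler_wpM2r//; lra.
by lra.
Qed.

End pathwise.

(** * Estimates on the exponent and on the weighted increments *)

Lemma sum_logterm_le (R : realType) (delta q : R) (L tau : nat) :
  0 < delta -> delta < 1 -> 0 <= q ->
  \sum_(s < tau) q * (s%:R + L%:R) * logterm delta s <=
  q * logterm delta tau * (tau%:R + L%:R) ^+ 2.
Proof.
move=> d0 d1 q0; set N := tau%:R + L%:R.
have b1 := logterm_ge1 d0 d1 tau.
have t0 : 0 <= tau%:R :> R by [].
have L0 : 0 <= L%:R :> R by [].
apply: (@le_trans _ _ (\sum_(s < tau) q * (N * logterm delta tau))).
  apply: ler_sum => s _; rewrite -mulrA ler_wpM2l//.
  have s1 := logterm_ge1 d0 d1 s.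
  have ss : (s <= tau)%N by rewrite ltnW.
  apply: ler_pM; [by rewrite addr_ge0|lra| |exact: le_logterm].
  by rewrite lerD2r ler_nat.
rewrite sumr_const card_ord -[leLHS]mulr_natr.
rewrite -!mulrA ler_wpM2l// mulrCA ler_wpM2l//; first by lra.
by rewrite expr2 ler_wpM2l// /N; lra.
Qed.

(** Put n = N / Nk, between 1 and 2. Since N - 1 >= 2N/3, the linear term is at least (1003/120)
    (2/3) b n >= 5 b n, while the quadratic one is 1.26 b n^2 <= 2.52 b n. The difference exceeds 2
    b n >= 2 b. *)
Lemma exponent_ge (R : realType) (A b N Nk S Q : R) :
  0 < A -> 1 <= b -> 3 <= N -> Nk <= N -> N < 2 * Nk ->
  1003 * A * b * (N - 1) <= S -> Q <= 9 * 1008 * A ^+ 2 * b * N ^+ 2 ->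
  2 * b <= (120 * A * Nk)^-1 * S - 2 * (120 * A * Nk)^-1 ^+ 2 * Q.
Proof.
move=> A0 b1 N3 NkN N2k hS hQ; set lam := (120 * A * Nk)^-1.
have S' : lam * (1003 * A * b * (N - 1)) <= lam * S.
  by rewrite ler_wpM2l// invr_ge0 !mulr_ge0 ?ler0n// ltW//; clear -N3 N2k; lra.
have Q' : 2 * lam ^+ 2 * Q <= 2 * lam ^+ 2 * (9 * 1008 * A ^+ 2 * b * N ^+ 2).
  by apply: ler_wpM2l => //; rewrite mulr_ge0 ?sqr_ge0.
apply: le_trans (lerB S' Q'); move: @lam {hS hQ S' Q'} => lam.
have Nk0 : 0 < Nk by lra.
pose n := N / Nk.
have n1 : 1 <= n by rewrite ler_pdivlMr//; lra.
have n2 : n <= 2 by rewrite ler_pdivrMr//; lra.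
have bn : 0 <= b * n by rewrite mulr_ge0//; lra.
have bn1 : b <= b * n by nra.
have bn2 : b * n ^+ 2 <= 2 * (b * n) by nra.
have Q' : 2 * lam ^+ 2 * (9 * 1008 * A ^+ 2 * b * N ^+ 2) =
    126 / 100 * (b * n ^+ 2).
  by rewrite /lam /n; field; apply/andP; split; [clear -Nk0|clear -A0]; lra.
have S' : 5 * (b * n) <= lam * (1003 * A * b * (N - 1)).
  have -> : lam * (1003 * A * b * (N - 1)) =
      1003 / 120 * (b * ((N - 1) / Nk)).
    by rewrite /lam; field; apply/andP; split; [clear -Nk0|clear -A0]; lra.
  have : b * (2 / 3 * n) <= b * ((N - 1) / Nk).
    rewrite ler_wpM2l//; first by lra.
    by rewrite /n mulrA ler_pM2r ?invr_gt0//; lra.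
  by clear -bn; lra.
by rewrite Q'; clear -bn bn1 bn2 S'; lra.
Qed.

Lemma dyadic_epoch (L n : nat) : (0 < L <= n)%N ->
  exists2 k, (2 ^ k * L <= n)%N & (n < 2 ^ k.+1 * L)%N.
Proof.
move=> /andP[L0 Ln]; exists (trunc_log 2 (n %/ L)).
  by rewrite -leq_divRL// trunc_logP// divn_gt0.
by rewrite -ltn_divLR// trunc_log_ltn.
Qed.

(* [M] is the shifted time t - 1 + L, so that eta_t = 2 / (C1 (M + 1)) and the
   weight is w_t = (M + 1) M. *)
Lemma weighted_drift_le (R : realType) (C1 C2 A M : R) :
  0 < C1 -> 0 < C2 -> C2 / C1 ^+ 2 <= A -> 3 <= M ->
  (M + 1) * M * (C2 * (2 / (C1 * (M + 1))) ^+ 2) <= 4 * A.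
Proof.
move=> C10 C20 C2A M3.
have -> : (M + 1) * M * (C2 * (2 / (C1 * (M + 1))) ^+ 2) =
    4 * (C2 / C1 ^+ 2) * (M / (M + 1)).
  by field; apply/andP; split; lra.
have MM : M / (M + 1) <= 1 by rewrite ler_pdivrMr; lra.
have MM0 : 0 <= M / (M + 1) by rewrite divr_ge0//; lra.
have C0 : 0 <= C2 / C1 ^+ 2 by rewrite divr_ge0 ?sqr_ge0// ltW.
by nra.
Qed.

(** With p = sqrt(c M b), the square-root part of the noise contributes at most 2 A p and the two C2
    parts at most 8 A. The condition 22 <= c gives p^2 >= 66, hence 8 <= p, so the total is at most
    3 A p. *)
Lemma weighted_increment_sqr_le (R : realType) (C1 C2 C3 A b c M l U Y : R) :
  0 < C1 -> 0 < C2 -> 0 < C3 -> 0 < A -> 1 <= b -> 22 <= c -> 3 <= M -> 0 <= l ->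
  C2 / C1 ^+ 2 <= A -> C3 ^+ 2 / C1 ^+ 2 <= A ->
  l <= c * A * (b / M) ->
  let eta := 2 / (C1 * (M + 1)) in
  `|Y| <= C2 * eta ^+ 2 ->
  `|U| <= C3 * eta * Num.sqrt l + C2 * eta ^+ 2 ->
  ((M + 1) * M * (U - Y)) ^+ 2 <= 9 * c * A ^+ 2 * M * b.
Proof.
move=> C10 C20 C30 A0 b1 c22 M3 l0 C2A C3A lb eta hY hU.
set p := Num.sqrt (c * M * b).
have Mb : 3 <= M * b by nra.
have cMb : 66 <= c * M * b by nra.
have p2 : p ^+ 2 = c * M * b by rewrite sqr_sqrtr//; lra.
have p0 : 0 <= p by exact: sqrtr_ge0.
have p8 : 8 <= p by rewrite -(@ler_pXn2r _ 2)// ?nnegrE// p2; lra.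
have X : C3 / C1 * Num.sqrt l <= A * p / M.
  rewrite -(@ler_pXn2r _ 2)// ?nnegrE.
  - rewrite exprMn sqr_sqrtr// expr_div_n.
    apply: (@le_trans _ _ (A * (c * A * (b / M)))).
      by apply: ler_pM => //; rewrite divr_ge0// sqr_ge0.
    rewrite expr_div_n exprMn p2 le_eqVlt; apply/orP; left; apply/eqP.
    by field; lra.
  - by rewrite mulr_ge0 ?sqrtr_ge0// divr_ge0// ltW.
  - by rewrite divr_ge0 ?mulr_ge0//; lra.
have D : `|(M + 1) * M * (U - Y)| <= 3 * A * p.
  rewrite normrM ger0_norm; last by rewrite mulr_ge0//; lra.
  apply: (@le_trans _ _ ((M + 1) * M * (C3 * eta * Num.sqrt l + 2 * (C2 * eta ^+ 2)))).
    rewrite ler_wpM2l ?mulr_ge0//; try lra.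
    by apply: le_trans (ler_normB _ _) _; lra.
  have -> : (M + 1) * M * (C3 * eta * Num.sqrt l + 2 * (C2 * eta ^+ 2)) =
      2 * M * (C3 / C1 * Num.sqrt l) + 8 * (C2 / C1 ^+ 2) * (M / (M + 1)).
    by rewrite /eta; field; apply/andP; split; lra.
  have X' : 2 * M * (C3 / C1 * Num.sqrt l) <= 2 * (A * p).
    rewrite -mulrA ler_pM2l// mulrC -ler_pdivlMr//; lra.
  have MM : M / (M + 1) <= 1 by rewrite ler_pdivrMr; lra.
  have MM0 : 0 <= M / (M + 1) by rewrite divr_ge0//; lra.
  have X2 : 8 * (C2 / C1 ^+ 2) * (M / (M + 1)) <= 8 * A.
    have C0 : 0 <= C2 / C1 ^+ 2 by rewrite divr_ge0 ?sqr_ge0// ltW.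
    by nra.
  by nra.
have -> : 9 * c * A ^+ 2 * M * b = (3 * A * p) ^+ 2.
  by rewrite exprMn p2; ring.
rewrite -[leLHS]real_normK ?num_real//.
by rewrite ler_pXn2r ?nnegrE// mulr_ge0//; lra.
Qed.

(** * The stopped exponential supermartingale and the union over epochs *)

Section recursion_tail.
Variables (d : measure_display) (T : measurableType d) (R : realType).
Variables (P : probability T R) (F : nat -> set (set T)).
Variables (Lp U Y : nat -> T -> R) (C1 C2 C3 : R) (L : nat) (a delta A : R).
Hypothesis filtF : filtration F.
Hypothesis adLp : adapted F Lp.
Hypothesis Lp0 : forall t x, 0 <= Lp t x.
Hypothesis adU : forall t B, measurable B -> F t.+1 (U t.+1 @^-1` B).
Hypotheses (C10 : 0 < C1) (C20 : 0 < C2) (C30 : 0 < C3) (L3 : (3 <= L)%N).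

Let eta (t : nat) : R := 2 / (C1 * (t%:R + L%:R)).

Hypothesis rec : {ae P, forall x, forall t,
  Lp t.+1 x <= (1 - C1 * eta t.+1) * Lp t x + U t.+1 x}.
Hypothesis condY : forall t, is_cond_exp P (F t) (U t.+1) (Y t).
Hypothesis bndY : {ae P, forall x, forall t, `|Y t x| <= C2 * eta t.+1 ^+ 2}.
Hypothesis bndU : {ae P, forall x, forall t,
  `|U t.+1 x| <= C3 * eta t.+1 * Num.sqrt (Lp t x) + C2 * eta t.+1 ^+ 2}.
Hypotheses (delta0 : 0 < delta) (delta1 : delta < 1).
Hypotheses (A0 : 0 < A) (aA : a * L%:R <= A * ln delta^-1).
Hypotheses (C2A : C2 / C1 ^+ 2 <= A) (C3A : C3 ^+ 2 / C1 ^+ 2 <= A).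

Let L3R : 3 <= L%:R :> R. Proof. by rewrite (ler_nat _ 3). Qed.

Let FE t : @measurable _ (g_sigma_algebraType (F t)) = F t.
Proof. by apply: measurable_g_measurableTypeE; case: filtF. Qed.

Let Fm t B : F t B -> measurable B.
Proof. by case: filtF => _ [h _]; exact: h. Qed.

Definition threshold (t : nat) : R :=
  1008 * A * (logterm delta t / (t%:R + L%:R)).

Definition good (t : nat) : set T :=
  [set x | forall s, (s <= t)%N -> Lp s x <= threshold s].

Definition weight (t : nat) : R := (t%:R + L%:R) * (t%:R + L%:R - 1).

Let etaS t : eta t.+1 = 2 / (C1 * (t%:R + L%:R + 1)).
Proof. by rewrite /eta -[t.+1%:R]natr1 addrAC. Qed.

Let C1_eta t : C1 * eta t.+1 = 2 / (t.+1%:R + L%:R).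
Proof. by rewrite /eta invfM mulrCA mulVKf// gt_eqF. Qed.

Lemma weightS t : weight t.+1 = (t%:R + L%:R + 1) * (t%:R + L%:R).
Proof. by rewrite /weight -natr1; ring. Qed.

Definition rate (k : nat) : R := (120 * A * (2 ^ k * L)%:R)^-1.

Definition increment_sqr_bound (t : nat) : R :=
  9 * 1008 * A ^+ 2 * (t%:R + L%:R) * logterm delta t.

(* Switching off outside [good t] freezes the product of the factors at the
   first violation, which makes a maximal inequality unnecessary. *)
Definition factor (k t : nat) (x : T) : R :=
  if x \in good t
  then expR (rate k * weight t.+1 * (U t.+1 x - Y t x) -
             2 * rate k ^+ 2 * increment_sqr_bound t)
  else 1.

Lemma good_adapted t : F t (good t).
Proof.
(* Padding with the whole space for s > t turns the event into a countable intersection of events of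
   [F t]. *)
have -> : good t = \bigcap_s
    (if (s <= t)%N then Lp s @^-1` `]-oo, threshold s] else setT).
  apply/seteqP; split => [x gx s _|x gx s st].
    by case: ifPn => // st; rewrite /= in_itv/=; exact: gx.
  by have := gx s Logic.I; rewrite st/= in_itv.
rewrite -FE; apply: bigcapT_measurable => s; case: ifPn => // st.
rewrite FE; case: filtF => _ [_ Fle]; apply: (Fle s t st); exact: adLp.
Qed.

Lemma factor_adapted k t : measurable_fun [set: g_sigma_algebraType (F t.+1)]
  (factor k t : g_sigma_algebraType (F t.+1) -> R).
Proof.
have Fle : F t `<=` F t.+1 by case: filtF => _ [_ h]; exact: h.
have mU : measurable_fun [set: g_sigma_algebraType (F t.+1)]
    (U t.+1 : g_sigma_algebraType (F t.+1) -> R).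
  by move=> _ B mB; rewrite setTI FE; exact: adU.
have mY : measurable_fun [set: g_sigma_algebraType (F t.+1)]
    (Y t : g_sigma_algebraType (F t.+1) -> R).
  move=> _ B mB; rewrite setTI FE; apply: Fle.
  by case: (condY t) => h _; exact: h.
apply: measurable_fun_ifT => //.
- apply: (measurable_fun_bool true); rewrite setTI preimage_mem_true FE.
  exact/Fle/good_adapted.
- apply: measurableT_comp => //; apply: measurable_funB => //.
  by apply: measurable_funM => //; exact: measurable_funB.
Qed.

Lemma factor_ge0 k t x : 0 <= factor k t x.
Proof. by rewrite /factor; case: ifP => // _; exact: expR_ge0. Qed.

(** On [good t] the threshold replaces the random value of the process in the noise bound, so the
    increment and its compensator are controlled by deterministic constants. *)
Lemma integral_factor_le k t B : F t B ->
  (\int[P]_(x in B) (factor k t x)%:E <= P B)%E.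
Proof.
move=> FB.
have [sF [_ _]] := filtF.
apply: (@le_integral_expR_cond_exp _ _ _ P (F t) (U t.+1) (Y t) (good t) B _ _
  (C3 * eta t.+1 * Num.sqrt (threshold t) + C2 * eta t.+1 ^+ 2)) => //.
- by move=> ?; exact: Fm.
- by move=> _ V mV; rewrite setTI; apply: (@Fm t.+1); exact: adU.
- exact: good_adapted.
- move: bndU; apply: filterS => x /(_ t) Ux gx; apply: le_trans Ux _.
  rewrite lerD2r ler_wpM2l//.
    by rewrite mulr_ge0 ?(ltW C30)// divr_ge0// mulr_ge0// ltW.
  by rewrite ler_wsqrtr//; exact: gx.
- apply: filterS2 bndU bndY => x /(_ t) Ux /(_ t) Yx gx.
  rewrite -mulrA exprMn mulrA ler_wpM2l//; first by rewrite mulr_ge0// sqr_ge0.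
  rewrite weightS; rewrite etaS in Ux Yx.
  apply: (weighted_increment_sqr_le C10 C20 C30 A0 _ _ _ (Lp0 t x) C2A C3A _ Yx Ux).
  - exact: logterm_ge1.
  - by rewrite ler_nat.
  - by rewrite ler_wpDl// L3R.
  - exact: gx.
Qed.

(** The horizon need only lie beyond every time of epoch k, because the product no longer changes
    after the first violation. *)
Definition epoch_event (k : nat) : set T :=
  [set x | (k.+1 * k.+2)%:R / delta <=
           \prod_(i < 2 ^ k.+1 * L) factor k i x].

Lemma factor_measurable k t : measurable_fun [set: T] (factor k t).
Proof.
move=> _ B mB; apply: (@Fm t.+1).
by have := @factor_adapted k t measurableT _ mB; rewrite FE.
Qed.

Lemma epoch_event_measurable k : measurable (epoch_event k).
Proof.
rewrite /epoch_event -[X in measurable X]setTI.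
apply: measurable_fun_le => //.
by apply: measurable_prod => i _; exact: factor_measurable.
Qed.

Lemma epoch_event_prob k :
  (P (epoch_event k) <= (delta / (k.+1 * k.+2)%:R)%:E)%E.
Proof.
set c := (k.+1 * k.+2)%:R / delta.
have c0 : 0 < c by rewrite divr_gt0// ltr0n.
pose Z x := \prod_(i < 2 ^ k.+1 * L) factor k i x.
have Z0 x : 0 <= Z x by apply: prodr_ge0 => i _; exact: factor_ge0.
have mZ : measurable_fun setT Z.
  by apply: measurable_prod => i _; exact: factor_measurable.
have Zint : (\int[P]_x (Z x)%:E <= 1)%E.
  apply: (@integral_prod_le1 _ _ _ P F (factor k)) => //.
  - exact: factor_ge0.
  - exact: factor_adapted.
  - exact: integral_factor_le.
have H : (c%:E * P (epoch_event k) <= 1)%E.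
  have -> : epoch_event k = [set: T] `&` [set x | (c%:E <= `|(EFin \o Z) x|)%E].
    by rewrite setTI; apply/seteqP; split => x /=; rewrite lee_fin ger0_norm.
  apply: le_trans Zint; rewrite (eq_integral (fun x => `|(EFin \o Z) x|)%E).
    apply: (@le_integral_comp_abse _ T R P setT measurableT (EFin \o Z) c id) => //.
    exact/measurable_EFinP.
  by move=> x _ /=; rewrite ger0_norm.
rewrite -(@lee_pmul2l _ c%:E) ?lte_fin// (le_trans H)// -EFinM lee_fin.
by rewrite -invf_div -/c divff// gt_eqF.
Qed.

Lemma violation_in_epoch x :
  (forall t, Lp t.+1 x <= (1 - C1 * eta t.+1) * Lp t x + U t.+1 x) ->
  (forall t, `|Y t x| <= C2 * eta t.+1 ^+ 2) ->
  Lp 0%N x <= a -> ~ (forall t, Lp t x <= threshold t) ->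
  exists k, epoch_event k x.
Proof.
move=> recx Yx L0a; rewrite -existsNE => -[t0 /negP viol0].
have [tau viol tmin] := ex_minnP (ex_intro (fun t => ~~ (Lp t x <= threshold t)) t0 viol0).
rewrite -ltNge in viol.
(* Being good at n concerns all times up to n, so by minimality of [tau] exactly the factors before
   [tau] are active. *)
have gP n : (x \in good n) = (n < tau)%N.
  apply/idP/idP => [|nt]; rewrite inE; last move=> s sn; first move=> gx.
    by rewrite ltnNge; apply/negP => /gx; rewrite leNgt viol.
  by apply: contraT => /tmin; rewrite leqNgt (leq_ltn_trans sn nt).
have [k kl ku] : exists2 k, (2 ^ k * L <= tau + L)%N & (tau + L < 2 ^ k.+1 * L)%N.
  by apply: dyadic_epoch; rewrite leq_addl (leq_trans _ L3).
exists k; rewrite /epoch_event/=.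
apply: le_trans (epoch_le_expR_logterm delta0 delta1 L3 kl) _.
have tT : (tau <= 2 ^ k.+1 * L)%N := leq_trans (leq_addr _ _) (ltnW ku).
(* The factors from [tau] on equal 1, so the product at the horizon is its value at the
   violation. *)
have -> : \prod_(i < 2 ^ k.+1 * L) factor k i x =
    \prod_(i < tau) expR (rate k * weight i.+1 * (U i.+1 x - Y i x) -
             2 * rate k ^+ 2 * increment_sqr_bound i).
  rewrite -(big_mkord xpredT (fun i => factor k i x)) (big_cat_nat (n := tau))//=.
  rewrite [X in _ * X]big_nat_cond [X in _ * X]big1 ?mulr1; last first.
    by move=> i /andP[/andP[ti _] _]; rewrite /factor gP ltnNge ti.
  rewrite big_mkord; apply: eq_bigr => i _.
  by rewrite /factor gP ltn_ord.
rewrite -expR_sum ler_expR sumrB.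
have -> : \sum_(i < tau) rate k * weight i.+1 * (U i.+1 x - Y i x) =
    rate k * \sum_(i < tau) weight i.+1 * (U i.+1 x - Y i x).
  by rewrite big_distrr/=; apply: eq_bigr => i _; rewrite mulrA.
rewrite -big_distrr/=.
apply: (exponent_ge A0 (logterm_ge1 delta0 delta1 tau) (N := tau%:R + L%:R)).
- by rewrite ler_wpDl// L3R.
- by rewrite -natrD ler_nat.
- by rewrite -natrD -natrM ltr_nat mulnA -expnS.
- apply: (@violation_noise_ge R L (Lp^~ x) (fun s => U s.+1 x) (Y^~ x) A L3 A0
    delta a tau delta0 delta1 aA L0a _ _ viol) => s _.
    by rewrite -C1_eta; exact: recx.
  apply: (@le_trans _ _ (weight s.+1 * (C2 * eta s.+1 ^+ 2))).
    by rewrite ler_wpM2l// weightS mulr_ge0// !addr_ge0.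
  by rewrite weightS etaS weighted_drift_le// ler_wpDl// L3R.
- apply: (@sum_logterm_le R delta (9 * 1008 * A ^+ 2) L tau delta0 delta1).
  by apply: mulr_ge0 (sqr_ge0 _); apply: mulr_ge0; exact: ler0n.
Qed.

(** The bound [g] is arbitrary because the lemma serves both [threshold] and the larger bound of the
    theorem. *)
Lemma all_le_measurable (g : nat -> R) :
  measurable [set x | forall t, Lp t x <= g t].
Proof.
have -> : [set x | forall t, Lp t x <= g t] =
    \bigcap_t (Lp t @^-1` `]-oo, g t]).
  apply/seteqP; split => [x h t _|x h t]; first by rewrite /= in_itv/=.
  by have := h t Logic.I; rewrite /= in_itv.
by apply: bigcapT_measurable => t; apply: (@Fm t); exact: adLp.
Qed.

(** Telescoping of 1/((k+1)(k+2)) = 1/(k+1) - 1/(k+2). *)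
Lemma nneseries_epoch : (\sum_(k <oo) (delta / (k.+1 * k.+2)%:R)%:E <= delta%:E)%E.
Proof.
apply: lime_le.
  by apply: is_cvg_nneseries => n _ _; rewrite lee_fin divr_ge0// ltW.
apply: nearW => n; rewrite sumEFin lee_fin.
suff -> : \sum_(0 <= k < n) delta / (k.+1 * k.+2)%:R = delta * (1 - n.+1%:R^-1).
  by rewrite ler_piMr ?(ltW delta0)// lerBlDr lerDl invr_ge0.
elim: n => [|n IH]; first by rewrite big_nil; lra.
rewrite big_nat_recr//= IH natrM -!natr1.
have n0 : 0 <= n%:R :> R by [].
by field; apply/andP; split; lra.
Qed.

Lemma below_threshold_prob :
  (P [set x | (Lp 0%N x <= a)%R] >= (1 - delta)%:E)%E ->
  (P [set x | forall t, (Lp t x <= threshold t)%R] >= (1 - 2 * delta)%:E)%E.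
Proof.
set I0 := [set x | (Lp 0%N x <= a)%R] => PI0.
set S := [set x | _].
have mS : measurable S by exact: all_le_measurable.
have mI0 : measurable I0.
  have -> : I0 = Lp 0%N @^-1` `]-oo, a].
    by apply/seteqP; split => x; rewrite /= in_itv.
  by apply: (@Fm 0%N); exact: adLp.
have [N [mN PN subN]] : {ae P, forall x,
    (forall t, Lp t.+1 x <= (1 - C1 * eta t.+1) * Lp t x + U t.+1 x) /\
    (forall t, `|Y t x| <= C2 * eta t.+1 ^+ 2)}.
  by apply: filterS2 rec bndY.
set E := \bigcup_k epoch_event k.
have mE : measurable E.
  by apply: bigcupT_measurable => k; exact: epoch_event_measurable.
have PE : (P E <= delta%:E)%E.
  apply: le_trans nneseries_epoch.
  apply: (@le_trans _ _ (\sum_(k <oo) P (epoch_event k))%E).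
    apply: measure_sigma_subadditive => //; exact: epoch_event_measurable.
  by apply: lee_nneseries => // k _; exact: epoch_event_prob.
(* A path that starts below [a] either stays below the threshold, lies in the null set, or triggers
   some epoch event; the last two together have probability at most delta. *)
have sub : I0 `<=` S `|` (N `|` E).
  move=> x I0x; have [Sx|nSx] := pselect (S x); [by left|right].
  have [Nx|nNx] := pselect (N x); [by left|right].
  have [recx Yx] : (forall t, Lp t.+1 x <= (1 - C1 * eta t.+1) * Lp t x + U t.+1 x) /\
    (forall t, `|Y t x| <= C2 * eta t.+1 ^+ 2).
    by apply: contrapT => h; apply: nNx; exact: subN.
  by have [k kx] := violation_in_epoch recx Yx I0x nSx; exists k.
have mNE : measurable (N `|` E) by exact: measurableU.
have PNE : (P (N `|` E) <= delta%:E)%E.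
  apply: le_trans PE; apply: le_trans (measureU2 P mN mE) _.
  by rewrite [X in (X + _)%E]PN add0e.
have : ((1 - delta)%:E <= P S + delta%:E)%E.
  apply: le_trans PI0 _.
  apply: (@le_trans _ _ (P (S `|` (N `|` E)))).
    by apply: le_measure => //; rewrite ?inE//; exact: measurableU.
  by apply: le_trans (measureU2 P mS mNE) _; rewrite leeD2l.
rewrite -(@fineK _ (P S)) ?fin_num_measure//.
by rewrite -EFinD !lee_fin; lra.
Qed.

End recursion_tail.

(** * The theorem, by matching constants *)

Theorem theorem2 (d : measure_display) (T : measurableType d) (R : realType)
  (P : probability T R) (F : nat -> set (set T))
  (Lp : nat -> T -> R) (U : nat -> T -> R)
  (C1 C2 C3 : R) (L : nat) (a delta : R) :
  filtration F ->
  adapted F Lp ->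
  (forall t x, 0 <= Lp t x) ->
  (forall t, (1 <= t)%N -> forall B : set R, measurable B -> F t (U t @^-1` B)) ->
  0 < C1 -> 0 < C2 -> 0 < C3 ->
  (3 <= L)%N ->
  let eta := fun t : nat => 2 / (C1 * (t%:R + L%:R)) in
  {ae P, forall x, forall t, (1 <= t)%N ->
     Lp t x <= (1 - C1 * eta t) * Lp t.-1 x + U t x} ->
  (forall t, (1 <= t)%N -> exists Y : T -> R,
     is_cond_exp P (F t.-1) (U t) Y /\
     {ae P, forall x, `|Y x| <= C2 * eta t ^+ 2}) ->
  {ae P, forall x, forall t, (1 <= t)%N ->
     `|U t x| <= C3 * eta t * Num.sqrt (Lp t.-1 x) + C2 * eta t ^+ 2} ->
  0 < a -> 0 < delta -> delta < 1 ->
  (P [set x | (Lp 0%N x <= a)%R] >= ((1 - delta)%R)%:E)%E ->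
  let K := Num.max (L%:R - 2) 32 * (if (32 <= L)%N then 1 else 32) in
  (P [set x | forall t : nat, (
      Lp t x <= (63 / 2) * K *
        Num.max (Num.max (a * L%:R / ln (delta^-1)) (C2 / C1 ^+ 2)) (C3 ^+ 2 / C1 ^+ 2) *
        ((ln (delta^-1) + 2 * ln (ln (t%:R + 9))) / (t%:R + L%:R)))%R]
   >= ((1 - 2 * delta)%R)%:E)%E.
Proof.
move=> filtF adLp Lp0 adU C10 C20 C30 L3 eta rec hY bndU a0 delta0 delta1 PL0.
cbv zeta; set K : R := Num.max (L%:R - 2) 32 * _.
set A := Num.max (Num.max _ _) _.
have lnd0 : 0 < ln delta^-1 := ln_deltaV_gt0 delta0 delta1.
have C2A : C2 / C1 ^+ 2 <= A by rewrite /A !le_max lexx orbT.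
have C3A : C3 ^+ 2 / C1 ^+ 2 <= A by rewrite /A le_max lexx orbT.
have aA : a * L%:R <= A * ln delta^-1.
  by rewrite -ler_pdivrMr// /A !le_max lexx.
have A0 : 0 < A by apply: lt_le_trans C2A; rewrite divr_gt0// exprn_gt0.
(* One version of each conditional mean is fixed, reindexed so that [Y t] belongs to step t+1; the
   countably many null sets are merged later by [ae_foralln]. *)
have /choice[Y condY] : forall t, exists Y : T -> R,
    is_cond_exp P (F t) (U t.+1) Y /\
    {ae P, forall x, `|Y x| <= C2 * eta t.+1 ^+ 2}.
  by move=> t; exact: (hY t.+1).
(* In both cases of [K] the maximum is at least 32 and its multiplier at least 1, so 31.5 K >= 31.5
   * 32 = 1008, the constant in [threshold]. *)
have K32 : 32 <= K.
  have m32 : 32 <= Num.max (L%:R - 2) 32 :> R by rewrite le_max lexx orbT.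
  by rewrite /K; case: ifP => _; lra.
have := @below_threshold_prob _ T R P F Lp U Y C1 C2 C3 L a delta A filtF adLp
  Lp0 (fun t => adU t.+1 isT) C10 C20 C30 L3 _ (fun t => (condY t).1) _ _
  delta0 delta1 A0 aA C2A C3A PL0.
move=> below; apply: le_trans (below _ _ _) _.
- by move: rec; apply: filterS => x h t; exact: (h t.+1).
- by apply: ae_foralln => t; have [] := condY t.
- by move: bndU; apply: filterS => x h t; exact: (h t.+1).
apply: le_measure; rewrite ?inE; [exact: all_le_measurable adLp _..|].
move=> x belowx t; apply: le_trans (belowx t) _.
have b0 : 0 <= logterm delta t / (t%:R + L%:R).
  by rewrite divr_ge0// (le_trans ler01)// logterm_ge1.
rewrite ler_wpM2r// ler_wpM2r ?(ltW A0)//.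
have -> : 1008 = 63 / 2 * 32 :> R by lra.
by rewrite ler_wpM2l.
Qed.
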